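(* Every randomized preemptive online algorithm for $\textsc{Part}$ with $p=2$, on sequences of positive integers with arbitrary weights, has expected competitive ratio at least $1.5$.
   Context: $\textsc{Part}$ with $p=2$: one separator must be placed in a sequence $w_1,\dots,w_n$ of positive integers to split it into two contiguous blocks minimizing the larger block weight (the bottleneck value). Preemptive online model: requests arrive one by one ($n$ unknown); when processing the current request the algorithm may remove its previously placed separator and can place a separator only right after the current request. The expected competitive ratio of a randomized algorithm is the supremum over inputs of the expected ratio between the bottleneck value of its output and the optimal bottleneck value. *)

(* Defs.v *)
From HB Require Import structures.
From mathcomp Require Import all_boot all_order all_algebra.
From mathcomp Require Import all_classical all_reals all_analysis.

Set Implicit Arguments.
Unset Strict Implicit.
Unset Printing Implicit Defensive.

Import Order.TTheory GRing.Theory Num.Theory.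

Local Open Scope classical_set_scope.
Local Open Scope ring_scope.

Definition requests : set (seq nat) :=
  [set w | w <> [::] /\ all (fun x => (0 < x)%N) w].

(* [Some i] is a separator right after the [i]-th request (counted from 1),
   [None] is the absence of a separator: one block then carries all the weight
   and the other one is empty. *)
Definition separator := option nat.

Definition bottleneck (w : seq nat) (s : separator) : nat :=
  if s is Some i then maxn (sumn (take i w)) (sumn (drop i w)) else sumn w.

Definition opt (w : seq nat) : nat :=
  \big[minn/bottleneck w None]_(i < size w) bottleneck w (Some i.+1).

Inductive action := Keep | Remove | Place.

Definition step (a : action) (i : nat) (s : separator) : separator :=
  match a with
  | Keep => s
  | Remove => None
  | Place => Some i
  end.

(* The action taken on a request is a function of the requests received so far,
   the current one included. The current separator need not be an argument: for
   a deterministic algorithm it is determined by these requests. *)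
Definition online_algorithm := seq nat -> action.

Definition output (A : online_algorithm) (w : seq nat) : separator :=
  foldl (fun s i => step (A (take i w)) i s) None (iota 1 (size w)).

Definition ratio (R : realType) (A : online_algorithm) (w : seq nat) : R :=
  (bottleneck w (output A w))%:R / (opt w)%:R.

(* A randomized algorithm is a random deterministic one: [t : T] is the outcome
   of all its coin tosses. *)
Record randomized_algorithm (d : measure_display) (T : measurableType d) := {
  decide :> T -> online_algorithm ;
  measurable_decide : forall (w : seq nat) (a : action),
    measurable [set t | decide t w = a] }.

Definition expected_competitive_ratio (R : realType) (d : measure_display)
    (T : measurableType d) (P : probability T R)
    (A : randomized_algorithm T) : \bar R :=
  ereal_sup [set expectation P (fun t => ratio R (A t) w) | w in requests].

(* Main.v *)
(* On the weights 1, 1, 2, 4, 8, ... the total doubles at every step and is split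
   evenly by placing the separator just before the last request.  With the
   separator after the last request the ratio is 2, right before it 1, and
   anywhere else at least 3/2.  The cheap position is available only if
   a separator was placed one step earlier, at ratio 2; charging 1/2 of that
   excess to the next step, the expected ratio after step n is at least
   3/2 + (p_n - p_(n-1)) / 2, where p_n is the probability of placing at step n.
   These bounds telescope, so the average expected ratio over the first N
   prefixes is at least 3/2 - 1/(2N). *)
Require Import Defs.
From mathcomp Require Import all_boot all_order all_algebra.
From mathcomp Require Import all_classical all_reals all_analysis.
From mathcomp Require Import measurable_realfun zify lra.

Set Implicit Arguments.
Unset Strict Implicit.
Unset Printing Implicit Defensive.

Import Order.TTheory GRing.Theory Num.Theory.

Local Open Scope classical_set_scope.
Local Open Scope ring_scope.

(** Being online, the algorithm takes its earlier actions on prefixes of [w], which appending [x]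
    leaves unchanged. *)
Lemma output_rcons (A : online_algorithm) (w : seq nat) (x : nat) :
  output A (rcons w x) = step (A (rcons w x)) (size w).+1 (output A w).
Proof.
rewrite /output size_rcons -[X in iota 1 X]addn1 iotaD foldl_cat /= add1n.
rewrite take_oversize ?size_rcons //; congr step.
have : {in iota 1 (size w), forall i, i <= size w}%N.
  by move=> i; rewrite mem_iota; lia.
elim: (iota _ _) None => //= i l IH s il.
rewrite -cats1 takel_cat; last by apply: il; rewrite inE eqxx.
by rewrite cats1 IH // => j jl; apply: il; rewrite inE jl orbT.
Qed.

Lemma output_leq (A : online_algorithm) (w : seq nat) (j : nat) :
  output A w = Some j -> (j <= size w)%N.
Proof.
elim/last_ind: w j => // w x IH j; rewrite output_rcons size_rcons.
by case: (A _) => //= [/IH /leqW|[<-]].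
Qed.

Lemma output_ltn (A : online_algorithm) (w : seq nat) (j : nat) :
  A w <> Place -> output A w = Some j -> (j < size w)%N.
Proof.
case/lastP: w => // w x; rewrite output_rcons size_rcons.
by case: (A _) => //= _ /output_leq.
Qed.

Definition doubling (n : nat) : seq nat := 1%N :: mkseq (expn 2) n.

Lemma size_doubling (n : nat) : size (doubling n) = n.+1.
Proof. by rewrite /= size_mkseq. Qed.

Lemma doublingS (n : nat) : doubling n.+1 = rcons (doubling n) (2 ^ n)%N.
Proof. by rewrite /doubling mkseqS. Qed.

Lemma doubling_requests (n : nat) : requests (doubling n).
Proof.
split=> //=; apply/allP => x /mapP[i _ ->].
by rewrite expn_gt0.
Qed.

Lemma sumn_doubling (n : nat) : sumn (doubling n) = (2 ^ n)%N.
Proof.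
by elim: n => // n IH; rewrite doublingS sumn_rcons IH expnS; lia.
Qed.

Lemma take_doubling (k n : nat) :
  (k <= n)%N -> take k.+1 (doubling n) = doubling k.
Proof. by move=> kn; rewrite /= /mkseq -map_take take_iota (minn_idPl kn). Qed.

Lemma leq_sumn_bottleneck (w : seq nat) (s : separator) :
  (sumn w <= (bottleneck w s).*2)%N.
Proof.
case: s => [i|] /=; last lia.
by rewrite -[X in sumn X](cat_take_drop i) sumn_cat; lia.
Qed.

Lemma bottleneck_doubling_final (n : nat) :
  bottleneck (doubling n) (Some n.+1) = (2 ^ n)%N.
Proof.
by rewrite /bottleneck take_doubling // drop_oversize ?size_doubling //
  sumn_doubling maxn0.
Qed.

(** The first block weighs at most a quarter of the total [2 ^ n.+1], so the second has at least
    three quarters of it. *)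
Lemma bottleneck_doubling_early (n j : nat) : (j <= n)%N ->
  (3 * 2 ^ n <= (bottleneck (doubling n.+1) (Some j)).*2)%N.
Proof.
move=> jn; rewrite /bottleneck.
have := sumn_doubling n.+1.
rewrite -[X in sumn X](cat_take_drop j) sumn_cat expnS.
suff: ((sumn (take j (doubling n.+1))).*2 <= 2 ^ n)%N by lia.
case: j jn => [|j] jn; first by rewrite take0.
rewrite take_doubling; last lia.
by rewrite sumn_doubling -mul2n -expnS leq_exp2l.
Qed.

Lemma opt_le_bottleneck (w : seq nat) (i : nat) : (i < size w)%N ->
  (opt w <= bottleneck w (Some i.+1))%N.
Proof.
move=> iw; rewrite /opt; have := mem_index_enum (Ordinal iw).
elim: (index_enum _) => // k r IH; rewrite inE big_cons geq_min.
by case/orP=> [/eqP <-|/IH ->]; rewrite ?leqnn ?orbT.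
Qed.

Lemma opt_doubling_le (n : nat) : (opt (doubling n.+1) <= 2 ^ n)%N.
Proof.
(* The witness is the separator just before the last request, which weighs as much as all the others
   together. *)
apply: (@leq_trans (bottleneck (doubling n.+1) (Some n.+1))).
  by apply: opt_le_bottleneck; rewrite size_doubling.
rewrite /bottleneck.
have := sumn_doubling n.+1.
rewrite -[X in sumn X](cat_take_drop n.+1) sumn_cat take_doubling //.
rewrite sumn_doubling expnS; lia.
Qed.

Lemma opt_gt0 (w : seq nat) : (0 < sumn w)%N -> (0 < opt w)%N.
Proof.
move=> w0; have b0 s : (0 < bottleneck w s)%N.
  by have := leq_sumn_bottleneck w s; lia.
by rewrite /opt; elim/big_ind: _ => // x y x0 y0; rewrite leq_min x0.
Qed.

Lemma in_set_asbool (T : Type) (B : set T) (t : T) : (t \in B) = `[< B t >].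
Proof. by []. Qed.

(** Composing with an arbitrary real-valued [F] avoids putting a sigma-algebra on [separator]. In
    the induction, the last action splits the outcomes into three measurable events. *)
Lemma measurable_output (R : realType) (d : measure_display)
    (T : measurableType d) (A : randomized_algorithm T) (F : separator -> R)
    (w : seq nat) : measurable_fun setT (fun t => F (output (A t) w)).
Proof.
elim/last_ind: w => [|w x IH]; first exact: (measurable_cst (F None)).
pose I a : T -> R := \1_[set t | A t (rcons w x) = a].
have mI a : measurable_fun setT (I a).
  by apply: measurable_indic; apply: measurable_decide.
rewrite [X in measurable_fun _ X](_ : _ = (fun t =>
  F (Some (size w).+1) * I Place t + F None * I Remove t +
  F (output (A t) w) * I Keep t)).
  by repeat apply: measurable_funD; apply: measurable_funM.
apply/funext => t; rewrite output_rcons /I !indicE !in_set_asbool /=.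
by case: (A t _); do 3 case: asboolP => // _;
  rewrite ?mulr1 ?mulr0 ?addr0 ?add0r.
Qed.

Definition places (T : Type) (A : T -> online_algorithm) (w : seq nat) :
    set T :=
  [set t | A t w = Place].

(** This is the charging argument for one fixed outcome of the coins: the left side is at most 2 if
    [A] places now, 1 if it placed only one step earlier, and 3/2 if it did neither. *)
Lemma ratio_doubling_ge (R : realType) (A : online_algorithm) (n : nat) :
  3 / 2 + (`[<A (doubling n.+1) = Place>]%:R -
           `[<A (doubling n) = Place>]%:R) / 2 <=
  Defs.ratio R A (doubling n.+1).
Proof.
set w := doubling n.+1; set b := bottleneck w (output A w).
have w2 : sumn w = (2 * 2 ^ n)%N by rewrite sumn_doubling expnS.
have b1 : (2 * 2 ^ n <= 2 * b)%N.
  by rewrite -w2 mul2n; exact: leq_sumn_bottleneck.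
have opt0 : (0 < opt w)%N by apply: opt_gt0; rewrite w2 muln_gt0 expn_gt0.
have: (b%:R : R) / (2 ^ n)%:R <= Defs.ratio R A w.
  rewrite /Defs.ratio ler_wpM2l // lef_pV2 ?posrE ?ltr0n ?expn_gt0 //.
  by rewrite ler_nat; exact: opt_doubling_le.
apply: le_trans; rewrite ler_pdivlMr ?ltr0n ?expn_gt0 //.
have b1R : (2 ^ n)%:R <= b%:R :> R by rewrite ler_nat; lia.
have p0 : 0 <= (2 ^ n)%:R :> R by [].
have outE : output A w = step (A w) n.+2 (output A (doubling n)).
  by rewrite /w doublingS output_rcons size_doubling.
have [Aw|Aw] := asboolP (A w = Place).
  have : b = (2 * 2 ^ n)%N.
    by rewrite /b outE Aw bottleneck_doubling_final expnS.
  move=> ->; rewrite natrM; case: asboolP => _ /=; lra.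
have [An|An] := asboolP (A (doubling n) = Place); first by rewrite /=; lra.
suff b32 : 3 * (2 ^ n)%:R <= 2 * b%:R :> R by rewrite /=; lra.
rewrite -!natrM ler_nat /b outE.
have none : (3 * 2 ^ n <= 2 * bottleneck w None)%N.
  by rewrite /bottleneck w2; lia.
(* [none] settles [Remove]. Under [Keep], an inherited separator predates the previous request,
   where nothing was placed, so it is early. *)
case: (A w) Aw => //= _.
case E: (output A (doubling n)) => [j|//].
rewrite mul2n; apply: bottleneck_doubling_early.
by have := output_ltn An E; rewrite size_doubling.
Qed.

Definition place_prob (R : realType) (d : measure_display)
    (T : measurableType d) (P : probability T R) (A : T -> online_algorithm)
    (n : nat) : R := fine (P (places A (doubling n))).

Lemma expectation_ratio_ge (R : realType) (d : measure_display)
    (T : measurableType d) (P : probability T R) (A : randomized_algorithm T)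
    (n : nat) :
  ((3 / 2 + (place_prob P A n.+1 - place_prob P A n) / 2)%:E <=
   expectation P (fun t => Defs.ratio R (A t) (doubling n.+1)))%E.
Proof.
have mp w : measurable (places A w) by exact: measurable_decide.
pose I k : T -> R := \1_(places A (doubling k)).
have LI k : I k \in Lfun P 1.
  by apply/Lfun1_integrable; exact: integrable_indic.
have LB : I n.+1 \- I n \in Lfun P 1 by rewrite rpredB.
(* [X] is the outcome-wise lower bound on the ratio as a random variable; linearity turns its
   indicators into probabilities. *)
pose X : T -> R := cst (3 / 2) \+ 2^-1 \o* (I n.+1 \- I n).
have <- : expectation P X =
    (3 / 2 + (place_prob P A n.+1 - place_prob P A n) / 2)%:E.
  rewrite expectationD ?Lfun_cst ?Lfun_scale //.
  rewrite expectation_cst expectationZl // expectationB //.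
  rewrite !expectation_indic //.
  rewrite -[P (places A (doubling n))]fineK ?fin_num_measure //.
  rewrite -[P (places A (doubling n.+1))]fineK ?fin_num_measure //.
  by rewrite -EFinB -EFinM -EFinD [2^-1 * _]mulrC.
apply: expectation_le => //.
- by apply: measurable_funD => //; apply: measurable_funM => //;
    apply: measurable_funB => //; exact: measurable_indic.
- exact: (measurable_output A
    (fun s => (bottleneck (doubling n.+1) s)%:R / (opt (doubling n.+1))%:R)).
- by move=> t; rewrite /X /I /= !indicE; do 2 case: (_ \in _) => /=; lra.
- by move=> t; rewrite /Defs.ratio divr_ge0.
- apply: aeW => t; have := ratio_doubling_ge R (A t) n.
  by rewrite /X /I /= !indicE !in_set_asbool.
Qed.

Theorem theorem7 (R : realType) (d : measure_display) (T : measurableType d)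
    (P : probability T R) (A : randomized_algorithm T) :
  ((3%:R / 2%:R : R)%R%:E <= expected_competitive_ratio P A)%E.
Proof.
pose p := place_prob P A.
have p01 k : 0 <= p k <= 1.
  have mp : measurable (places A (doubling k)) by exact: measurable_decide.
  by rewrite -!lee_fin fineK ?fin_num_measure // measure_ge0 probability_le1.
have step_le n :
    ((3 / 2 + (p n.+1 - p n) / 2)%:E <= expected_competitive_ratio P A)%E.
  apply: le_trans (expectation_ratio_ge P A n) _; apply: ereal_sup_ubound.
  by exists (doubling n.+1) => //; exact: doubling_requests.
case: (expected_competitive_ratio P A) step_le => [m| |] step_le; last 2 first.
- by rewrite leey.
- by have := step_le 0%N; rewrite leeNy_eq.
rewrite lee_fin leNgt; apply/negP => m32.
(* Summing the first [N] bounds telescopes the probabilities, and each expected ratio is at most the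
   supremum [m]. *)
have avg_le N : N%:R * (3 / 2) + (p N - p 0%N) / 2 <= N%:R * m.
  elim: N => [|N IH]; first by rewrite !mul0r subrr mul0r addr0.
  by have := step_le N; rewrite lee_fin -natr1; lra.
have gap : 0 < 3 / 2 - m by lra.
have := truncnS_gt (3 / 2 - m)^-1.
(* With this [N] the accumulated gap [N * (3 / 2 - m)] exceeds 1, whereas [avg_le] caps it at
   [(p 0 - p N) / 2], hence at 1/2. *)
set N := (Num.trunc _).+1; rewrite -(ltr_pM2r gap) mulVf ?gt_eqF // => N1.
by have := avg_le N; have := p01 N; have := p01 0%N; lra.
Qed.
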